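(* Let $R$ be a Noetherian ring of characteristic $p>0$. If $\mathfrak{a}\subseteq R$ is an ideal generated by $r$ elements ($r\ge 1$), then $$\tau(\mathfrak{a}^{n+r-1})\subseteq\mathfrak{a}^n$$ for all $n\ge 0$. If we assume further that $R$ is a complete local ring, then $$\tau(\mathfrak{a}^{n+r-1}\mathfrak{b})\subseteq\tau(\mathfrak{b})\,\mathfrak{a}^n$$ for all $n\ge 0$ and all ideals $\mathfrak{b}\subseteq R$.
   Context: All rings are commutative with unity; $\mathfrak{a}^0=R$. $R^{\circ}$ is the set of elements of $R$ not in any minimal prime. For $R$ of characteristic $p>0$, $q$ always denotes a power $p^e$ ($e\ge0$). ${}^e\!R$ is $R$ viewed as an $R$-module via the $e$-th iterated Frobenius $F^e\colon R\to R$; for an $R$-module $M$, $\mathbb{F}^e(M)={}^e\!R\otimes_R M$, an $R$-module via the left factor; for $z\in M$, $z^q:=1\otimes z\in\mathbb{F}^e(M)$; for a submodule $N\subseteq M$, $N^{[q]}_M$ is the image of $\mathbb{F}^e(N)\to\mathbb{F}^e(M)$. For an ideal $\mathfrak{a}$, the $\mathfrak{a}$-tight closure $N^{*\mathfrak{a}}_M$ of $N$ in $M$ is the set of $z\in M$ for which there is $c\in R^{\circ}$ with $cz^q\mathfrak{a}^q\subseteq N^{[q]}_M$ for all large $q=p^e$ (here $\mathfrak{a}^q$ is the ordinary power). The ideal $\tau(\mathfrak{a})$ is $\bigcap_M\operatorname{Ann}_R(0^{*\mathfrak{a}}_M)$, with $M$ running over all finitely generated $R$-modules; equivalently, over all finitely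 generated submodules $M$ of $E=\bigoplus_{\mathfrak{m}}E_R(R/\mathfrak{m})$, the direct sum over all maximal ideals $\mathfrak{m}$ of the injective envelopes of $R/\mathfrak{m}$. *)

(* Defs.v *)
From HB Require Import structures.
From mathcomp Require Import all_boot all_order all_algebra.
From mathcomp Require Import boolp classical_sets.
From mathcomp Require Import freeg.

Set Implicit Arguments.
Unset Strict Implicit.
Unset Printing Implicit Defensive.

Import GRing.Theory.

Local Open Scope classical_set_scope.
Local Open Scope ring_scope.

(* A (x)_R M is the free abelian group on A * M modulo the subgroup generated *)
(* by the relations of biadditivity and R-balancedness.                       *)
Section Tensor.
Variables (R : comNzRingType) (A M : lmodType R).

Definition tensor_gens : set {freeg (A * M)%type} :=
  [set << (x.1.1 + x.1.2, x.2) >> - << (x.1.1, x.2) >> - << (x.1.2, x.2) >>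
     | x in [set: A * A * M]] `|`
  [set << (x.1, x.2.1 + x.2.2) >> - << (x.1, x.2.1) >> - << (x.1, x.2.2) >>
     | x in [set: A * (M * M)]] `|`
  [set << (x.1 *: x.2.1, x.2.2) >> - << (x.2.1, x.1 *: x.2.2) >>
     | x in [set: R * (A * M)]].

Definition tensor_rels : {pred {freeg (A * M)%type}} :=
  [in smallest (fun S => zmod_closed [in S]) tensor_gens].

Lemma tensor_rels_closed : zmod_closed tensor_rels.
Proof.
split=> [|x y]; rewrite /tensor_rels /= !in_setE.
  by move=> S [[S0 _] _]; move: S0; rewrite in_setE.
move=> hx hy S hS; have [[_ SB] _] := hS.
by have := SB x y; rewrite !in_setE; apply; [exact: hx|exact: hy].
Qed.

HB.instance Definition _ :=
  GRing.isZmodClosed.Build {freeg (A * M)%type} tensor_rels tensor_rels_closed.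

Definition tensor : Type := Quotient.quot tensor_rels.
HB.instance Definition _ := GRing.Zmodule.on tensor.

Definition to_tensor (D : {freeg (A * M)%type}) : tensor :=
  (\pi_(Quotient.quot tensor_rels) D)%qT.

Definition pure (a : A) (m : M) : tensor := to_tensor << (a, m) >>.

(* The additive map A (x) M -> V induced by B; it is meaningful only for B    *)
(* biadditive and balanced.                                                   *)
Definition tensor_lift (V : zmodType) (B : A -> M -> V) (t : tensor) : V :=
  fglift (fun x : A * M => B x.1 x.2 : zmodule V)
    (repr (t : Quotient.quot tensor_rels)).

Lemma to_tensor_additive : {morph to_tensor : x y / x - y}.
Proof. exact: raddfB. Qed.
HB.instance Definition _ :=
  GRing.isZmodMorphism.Build {freeg (A * M)%type} tensor to_tensor to_tensor_additive.

Lemma to_tensorP (t : tensor) : exists D, t = to_tensor D.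
Proof. by exists (repr (t : Quotient.quot tensor_rels)); rewrite /to_tensor reprK. Qed.

Lemma to_tensor_eq0 D : tensor_gens D -> to_tensor D = 0.
Proof.
move=> gD; apply/eqP; rewrite -[0](raddf0 to_tensor); apply/eqP.
rewrite /to_tensor; apply/eqP; rewrite -Quotient.idealrBE subr0 /tensor_rels /= in_setE.
exact: sub_gen_smallest.
Qed.

Lemma pureDl m : {morph pure^~ m : a b / a + b}.
Proof.
move=> a b; apply/eqP; rewrite -subr_eq0 opprD addrA /pure -!raddfB; apply/eqP.
by apply: to_tensor_eq0; left; left; exists (a, b, m).
Qed.

Lemma pureDr a : {morph pure a : m n / m + n}.
Proof.
move=> m n; apply/eqP; rewrite -subr_eq0 opprD addrA /pure -!raddfB; apply/eqP.
by apply: to_tensor_eq0; left; right; exists (a, (m, n)).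
Qed.

Lemma pureZ r a m : pure (r *: a) m = pure a (r *: m).
Proof.
apply/eqP; rewrite -subr_eq0 /pure -!raddfB; apply/eqP.
by apply: to_tensor_eq0; right; exists (r, (a, m)).
Qed.

Lemma tensor_ind (P : tensor -> Prop) :
  P 0 -> (forall a m t, P t -> P (pure a m + t)) ->
  (forall a m t, P t -> P (- pure a m + t)) -> forall t, P t.
Proof.
move=> P0 PD PB t; have [D ->] := to_tensorP t.
rewrite -(freeg_sumE D) raddf_sum /=; elim: (dom D) => [|x s IH].
  by rewrite big_nil.
rewrite big_cons; move: (coeff x D) => k.
have -> : to_tensor << k *g x >> = pure x.1 x.2 *~ k.
  by rewrite /pure -surjective_pairing -raddfMz freegU_mulz intz.
move: (\sum_(j <- s) _) IH => S PS.
elim: k => [|n IHn|n IHn]; first by rewrite mulr0z add0r.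
- by rewrite intS mulrzDr mulr1z -addrA; apply: PD.
- by rewrite intS opprD mulrzDr mulrN1z -addrA; apply: PB.
Qed.

Section Lift.
Variables (V : zmodType) (B : A -> M -> V).
Hypothesis BDl : forall m, {morph B^~ m : a b / a + b}.
Hypothesis BDr : forall a, {morph B a : m n / m + n}.
Hypothesis BZ : forall r a m, B (r *: a) m = B a (r *: m).

Let L := fglift (fun x : A * M => B x.1 x.2 : zmodule V).

Let LB : {morph L : x y / x - y}.
Proof. exact: lift_is_additive. Qed.
Let L0 : L 0 = 0. Proof. by rewrite -(subrr 0) LB subrr. Qed.

Lemma tensor_lift_to D : tensor_lift B (to_tensor D) = L D.
Proof.
rewrite /tensor_lift -/L; set E := repr _.
have : E - D \in tensor_rels.
  by rewrite Quotient.idealrBE /E /to_tensor reprK.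
rewrite /tensor_rels /= in_setE => /(_ [set F | L F = 0]) /=.
move=> H; apply/eqP; rewrite -subr_eq0; apply/eqP.
rewrite -[LHS]LB; apply: H; split.
  split; first by rewrite in_setE /=; exact: L0.
  move=> x y; rewrite !in_setE /= => x0 y0.
  by rewrite [LHS]LB x0 y0 subrr.
have LU x : L << x >> = B x.1 x.2 by rewrite /L liftU scale1r.
move=> F [[|]|] [x _ <-] /=; rewrite !LB !LU /=.
- by rewrite BDl addrAC addrK subrr.
- by rewrite BDr addrAC addrK subrr.
- by rewrite BZ subrr.
Qed.

Lemma tensor_lift_pure a m : tensor_lift B (pure a m) = B a m.
Proof. by rewrite tensor_lift_to /L liftU scale1r. Qed.

Lemma tensor_lift_additive : {morph tensor_lift B : s t / s - t}.
Proof.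
move=> s t; have [D ->] := to_tensorP s; have [E ->] := to_tensorP t.
by rewrite -raddfB !tensor_lift_to; exact: LB.
Qed.

End Lift.
End Tensor.

Definition restr (R S : comNzRingType) (phi : {rmorphism R -> S}) : Type := S.

Section RestrictionOfScalars.
Variables (R S : comNzRingType) (phi : {rmorphism R -> S}).

HB.instance Definition _ := GRing.ComNzRing.on (restr phi).

Let scale (r : R) (s : restr phi) : restr phi := (phi r : S) * s.

Let scaleA a b v : scale a (scale b v) = scale (a * b) v.
Proof. by rewrite /scale rmorphM mulrA. Qed.
Let scale1 : left_id 1 scale.
Proof. by move=> v; rewrite /scale rmorph1 mul1r. Qed.
Let scaleDr : right_distributive scale +%R.
Proof. by move=> a u v; rewrite /scale mulrDr. Qed.
Let scaleDl v : {morph scale^~ v : a b / a + b}.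
Proof. by move=> a b; rewrite /scale rmorphD mulrDl. Qed.

HB.instance Definition _ := GRing.Zmodule_isLmodule.Build R (restr phi)
  scaleA scale1 scaleDr scaleDl.

Lemma restr_scaleE (r : R) (s : S) :
  r *: (s : restr phi) = ((phi r * s : S) : restr phi).
Proof. by []. Qed.

End RestrictionOfScalars.

Definition base_change (R S : comNzRingType) (phi : {rmorphism R -> S})
  (M : lmodType R) : Type := tensor (restr phi) M.

Section BaseChange.
Variables (R S : comNzRingType) (phi : {rmorphism R -> S}) (M : lmodType R).

HB.instance Definition _ := GRing.Zmodule.on (base_change phi M).

Let mulpure (c : S) (s : restr phi) (m : M) : base_change phi M :=
  pure ((c * (s : S) : S) : restr phi) m.

Let scale (c : S) (t : base_change phi M) : base_change phi M :=
  tensor_lift (mulpure c) t.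

Let mulpureDl c m : {morph (mulpure c)^~ m : a b / a + b}.
Proof. by move=> a b; rewrite /mulpure mulrDr; exact: pureDl. Qed.
Let mulpureDr c a : {morph mulpure c a : m n / m + n}.
Proof. by move=> m n; exact: pureDr. Qed.
Let mulpureZ c r a m : mulpure c (r *: a) m = mulpure c a (r *: m).
Proof. by rewrite /mulpure -pureZ !restr_scaleE mulrCA. Qed.

Let scale_pure c s m : scale c (pure s m) = mulpure c s m.
Proof.
exact: (tensor_lift_pure (mulpureDl c) (mulpureDr c) (mulpureZ c)).
Qed.

Let scaleB c : {morph scale c : s t / s - t}.
Proof.
exact: (tensor_lift_additive (mulpureDl c) (mulpureDr c) (mulpureZ c)).
Qed.
Let scale0 c : scale c 0 = 0.
Proof. by rewrite -(subrr 0) scaleB !subrr. Qed.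
Let scaleN c t : scale c (- t) = - scale c t.
Proof. by rewrite -[- t]add0r scaleB scale0 add0r. Qed.
Let scaleDr : right_distributive scale +%R.
Proof. by move=> c s t; rewrite -{1}(opprK t) scaleB scaleN opprK. Qed.
Let scaleA a b t : scale a (scale b t) = scale (a * b) t.
Proof.
elim/tensor_ind: t => [|s m t IH|s m t IH]; first by rewrite !scale0.
  by rewrite !scaleDr IH !scale_pure /mulpure mulrA.
by rewrite !scaleDr !scaleN IH !scale_pure /mulpure mulrA.
Qed.
Let scale1 : left_id 1 scale.
Proof.
move=> t; elim/tensor_ind: t => [|s m t IH|s m t IH]; first by rewrite !scale0.
  by rewrite !scaleDr IH !scale_pure /mulpure mul1r.
by rewrite !scaleDr !scaleN IH !scale_pure /mulpure mul1r.
Qed.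
Let scaleDl t : {morph scale^~ t : a b / a + b}.
Proof.
move=> a b; elim/tensor_ind: t => [|s m t IH|s m t IH].
- by rewrite !scale0 addr0.
- rewrite !scaleDr IH !scale_pure addrACA; congr (_ + _).
  by rewrite /mulpure mulrDl; exact: pureDl.
- rewrite !scaleDr !scaleN IH !scale_pure addrACA -opprD; congr (- _ + _).
  by rewrite /mulpure mulrDl; exact: pureDl.
Qed.

HB.instance Definition _ := GRing.Zmodule_isLmodule.Build S (base_change phi M)
  scaleA scale1 scaleDr scaleDl.

Lemma base_change_scale_pure (c s : S) (m : M) :
  c *: (pure (s : restr phi) m : base_change phi M) =
  pure ((c * s : S) : restr phi) m.
Proof. exact: scale_pure. Qed.

End BaseChange.

Definition base_change_map (R S : comNzRingType) (phi : {rmorphism R -> S})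
    (N M : lmodType R) (f : {linear N -> M}) (t : base_change phi N) :
    base_change phi M :=
  tensor_lift (fun s n => pure s (f n)) t.

Definition submod_type (R : comNzRingType) (M : lmodType R)
  (N : submodClosed M) : Type := {x : M | x \in N}.

Section SubmodType.
Variables (R : comNzRingType) (M : lmodType R) (N : submodClosed M).
HB.instance Definition _ := SubChoice.on (submod_type N).
HB.instance Definition _ := [SubChoice_isSubLmodule of submod_type N by <:].
End SubmodType.

Definition zero_submod (R : comNzRingType) (M : lmodType R) : {pred M} := pred1 0.

Section ZeroSubmod.
Variables (R : comNzRingType) (M : lmodType R).
Lemma zero_submod_closed : submod_closed (@zero_submod R M).
Proof.
split=> [|a u v]; rewrite !inE // => /eqP-> /eqP->.
by rewrite scaler0 addr0.
Qed.
HB.instance Definition _ :=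
  GRing.isSubmodClosed.Build R M (@zero_submod R M) zero_submod_closed.
End ZeroSubmod.

Section Ideals.
Variable R : comNzRingType.

Definition span (M : lmodType R) (X : set M) : set M :=
  smallest (fun N => submod_closed [in N]) X.

Definition fin_gen (M : lmodType R) : Prop :=
  exists s : seq M, span [set` s] = setT.

Definition ideal (I : set R) : Prop := submod_closed [in (I : set R^o)].

Definition ideal_gen (X : set R) : set R := span (X : set R^o).

Definition ideal_mul (I J : set R) : set R :=
  ideal_gen [set x * y | x in I & y in J].

(* The zeroth power is the unit ideal, also for I = 0. *)
Definition ideal_exp (I : set R) (n : nat) : set R := iter n (ideal_mul I) setT.

Definition noetherian : Prop :=
  forall I, ideal I -> exists s : seq R, I = ideal_gen [set` s].

Definition prime_ideal (P : set R) : Prop :=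
  [/\ ideal P, ~ P 1 & forall x y, P (x * y) -> P x \/ P y].

Definition minimal_prime (P : set R) : Prop :=
  prime_ideal P /\ forall Q, prime_ideal Q -> Q `<=` P -> Q = P.

(* The set written R with a superscript circle. *)
Definition circ : set R := [set c | forall P, minimal_prime P -> ~ P c].

Definition maximal_ideal (m : set R) : Prop :=
  [/\ ideal m, ~ m 1 & forall J, ideal J -> ~ J 1 -> m `<=` J -> J = m].

(* Bijectivity of the canonical map from R to the inverse limit of the        *)
(* R / m^n, a point of the limit being given by a sequence of representatives.*)
Definition adically_complete (m : set R) : Prop :=
  forall u : nat -> R, (forall n, ideal_exp m n (u n.+1 - u n)) ->
  exists! l, forall n, ideal_exp m n (u n - l).

Definition complete_local : Prop :=
  exists m, [/\ maximal_ideal m, forall m', maximal_ideal m' -> m' = m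
              & adically_complete m].

End Ideals.

Section TightClosure.
Variables (R : comNzRingType) (p : nat) (chRp : p \in [pchar R]).

Definition frobenius (e : nat) : R -> R := iter e (pFrobenius_aut chRp).

Lemma frobenius_zmod e : zmod_morphism (frobenius e).
Proof. by elim: e => [|e IH] x y //=; rewrite IH rmorphB. Qed.
Lemma frobenius_monoid e : monoid_morphism (frobenius e).
Proof.
split; first by elim: e => [|e IH] //=; rewrite IH rmorph1.
by elim: e => [|e IH] x y //=; rewrite IH rmorphM.
Qed.
HB.instance Definition _ e :=
  GRing.isZmodMorphism.Build R R (frobenius e) (frobenius_zmod e).
HB.instance Definition _ e :=
  GRing.isMonoidMorphism.Build R R (frobenius e) (frobenius_monoid e).

(* The functor F^e : M |-> eR (x)_R M, with R acting on the left factor. *)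
Definition frob (e : nat) (M : lmodType R) : lmodType R :=
  base_change (frobenius e) M.

Definition frob_map (e : nat) (N M : lmodType R) (f : {linear N -> M}) :
  frob e N -> frob e M := base_change_map f.

(* z^q *)
Definition frob_elt (e : nat) (M : lmodType R) (z : M) : frob e M :=
  pure (1 : restr (frobenius e)) z.

(* N^[q]_M *)
Definition frob_submod (e : nat) (M : lmodType R) (N : submodClosed M) :
    set (frob e M) :=
  range (frob_map (e := e) (\val : submod_type N -> M)).
Arguments frob_submod e {M} N _.

(* N^{*a}_M *)
Definition tight_closure (a : set R) (M : lmodType R) (N : submodClosed M) :
    set M :=
  [set z : M | exists2 c, circ c & exists e0, forall e, (e0 <= e)%N ->
     [set (c * x) *: frob_elt e z | x in ideal_exp a (p ^ e)]
       `<=` frob_submod e N].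

Definition tau (a : set R) : set R :=
  [set x | forall M : lmodType R, fin_gen M ->
     forall z : M, tight_closure a (@zero_submod R M) z -> x *: z = 0].

End TightClosure.

Arguments frob_map {R p} chRp e {N M} f _.
Arguments frob_submod {R p} chRp e {M} N _.

(* Main.v *)
From HB Require Import structures.
Require Import Defs.
From mathcomp Require Import all_boot all_order all_algebra.
From mathcomp Require Import boolp classical_sets.
From mathcomp Require Import zify.

(* For z in the b-tight closure of 0 in M and generators h_1, ..., h_s of     *)
(* a^n, let w be the class of (1, 0) in (R + M^s) modulo h_i w = z e_i. By    *)
(* the pigeonhole inclusion of a^((n + r - 1) q) in (a^n)^[q], w lies in the  *)
(* a^(n+r-1) b-tight closure of 0, while Ann(w) = Ann(z) a^n; so              *)
(* tau(a^(n+r-1) b) is contained in Ann(z) a^n. The first inclusion is the    *)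
(* case b = R, z = 0. In the complete local case Chevalley's theorem gives,   *)
(* for each k, a z with Ann(z) contained in tau(b) + m^k, and Krull's         *)
(* intersection theorem for tau(b) a^n concludes; no Matlis duality is used.  *)

Set Implicit Arguments.
Unset Strict Implicit.
Unset Printing Implicit Defensive.

Import GRing.Theory.

Local Open Scope quotient_scope.
Local Open Scope classical_set_scope.
Local Open Scope ring_scope.

(** Everything rests on one inclusion, [tau_sub_ann_mul]: if [z] lies in the [b]-tight closure of 0
    in a finitely generated [M], then tau(a^(n+r-1) b) is contained in Ann(z) a^n. To prove it, an
    element [w] is adjoined to M^s by the equations h_i w = z e_i, where the h_i generate a^n. For l
    = sum l_i h_i one has l w = sum l_i z e_i, so a multiplier c that kills z^q b^q also kills l^q
    w^q b^q. By [ideal_exp_frobenius_power] such l^q generate an ideal containing a^((n+r-1)q), so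
    [w] lies in the tight closure of 0 for a^(n+r-1) b ([tight_closure_root]). What kills [w] lies
    in Ann(z) a^n ([ann_root_elt]).

    Taking z = 0 and b = R gives the first inclusion. For the second, tau(b) is the intersection of
    the ideals Ann(z), and these form a filtered family because pairs of elements can be taken. Over
    a complete local ring [chevalley] finds Ann(z) inside tau(b) + m^k, so the left side lies in
    tau(b) a^n + m^k for every k, and [krull_intersection] removes m^k. *)

Section Span.
Variables (R : comNzRingType) (M : lmodType R).
Implicit Types (N X : set M).

Lemma submod_setP N :
  submod_closed [in N] <->
  N 0 /\ forall k u v, N u -> N v -> N (k *: u + v).
Proof.
split=> -[N0 NP].
  split=> [|k u v Nu Nv]; first by move: N0; rewrite in_setE.
  by have := NP k u v; rewrite !in_setE; apply.
split=> [|k u v]; rewrite !in_setE //; exact: NP.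
Qed.

Lemma span_submod X : submod_closed [in Defs.span X].
Proof.
apply/submod_setP; split=> [N [/submod_setP[N0 _] _] //|k u v Xu Xv N hN].
have [/submod_setP[_ NP] _] := hN.
by apply: NP; [exact: Xu|exact: Xv].
Qed.

Lemma subset_span X : X `<=` Defs.span X.
Proof. exact: sub_gen_smallest. Qed.

Lemma span_min X N : submod_closed [in N] -> X `<=` N -> Defs.span X `<=` N.
Proof. exact: smallest_sub. Qed.

End Span.

(** * Arithmetic of ideals: sums, products, powers and colons *)

Section Ideals.
Variable R : comNzRingType.
Implicit Types (I J K X : set R) (x y : R).

Lemma idealP I : ideal I <-> I 0 /\ forall k x y, I x -> I y -> I (k * x + y).
Proof. exact: (@submod_setP R R^o I). Qed.

Lemma ideal0 I : ideal I -> I 0.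
Proof. by case/idealP. Qed.

Lemma idealD I x y : ideal I -> I x -> I y -> I (x + y).
Proof. by case/idealP=> _ IP Ix Iy; rewrite -[x]mul1r; exact: IP. Qed.

Lemma idealM I k x : ideal I -> I x -> I (k * x).
Proof. by case/idealP=> I0 IP Ix; rewrite -[k * x]addr0; exact: IP. Qed.

Lemma idealMC I k x : ideal I -> I x -> I (x * k).
Proof. by rewrite mulrC; exact: idealM. Qed.

Lemma idealN I x : ideal I -> I x -> I (- x).
Proof. by rewrite -mulN1r; exact: idealM. Qed.

Lemma idealB I x y : ideal I -> I x -> I y -> I (x - y).
Proof. by move=> iI Ix Iy; apply: idealD => //; apply: idealN. Qed.

Lemma ideal_full I : ideal I -> I 1 -> I = setT.
Proof.
move=> iI I1; apply/seteqP; split=> // x _.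
by rewrite -[x]mulr1; apply: idealM.
Qed.

Lemma idealT : ideal [set: R].
Proof. by apply/idealP. Qed.

Lemma ideal_genP X : ideal (ideal_gen X).
Proof. exact: (@span_submod R R^o X). Qed.

Lemma sub_ideal_gen X : X `<=` ideal_gen X.
Proof. exact: (@subset_span R R^o). Qed.

Lemma ideal_gen_min X I : ideal I -> X `<=` I -> ideal_gen X `<=` I.
Proof. exact: (@span_min R R^o). Qed.

Definition ideal_add I J : set R := [set z | exists2 x, I x & J (z - x)].

Lemma ideal_addP I J : ideal I -> ideal J -> ideal (ideal_add I J).
Proof.
move=> iI iJ; apply/idealP; split=> [|k x y [u Iu Ju] [v Iv Jv]].
  by exists 0; rewrite ?subr0; exact: ideal0.
exists (k * u + v); first exact: (idealD iI (idealM k iI Iu) Iv).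
have -> : k * x + y - (k * u + v) = k * (x - u) + (y - v).
  by rewrite mulrBr opprD addrACA.
exact: (idealD iJ (idealM k iJ Ju) Jv).
Qed.

Lemma ideal_addl I J : ideal J -> I `<=` ideal_add I J.
Proof. by move=> iJ x Ix; exists x => //; rewrite subrr; apply: ideal0. Qed.

Lemma ideal_addr I J : ideal I -> J `<=` ideal_add I J.
Proof. by move=> iI x Jx; exists 0; rewrite ?subr0 //; apply: ideal0. Qed.

Lemma ideal_add_min I J K :
  ideal K -> I `<=` K -> J `<=` K -> ideal_add I J `<=` K.
Proof.
move=> iK IK JK z [x /IK Kx /JK Kzx].
by rewrite -(subrK x z); apply: idealD.
Qed.

Definition principal x : set R := [set k * x | k in [set: R]].

Lemma principalP x : ideal (principal x).
Proof.
apply/idealP; split=> [|k _ _ [u _ <-] [v _ <-]]; first by exists 0; rewrite ?mul0r.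
by exists (k * u + v); rewrite // mulrDl mulrA.
Qed.

Lemma principal_id x : principal x x.
Proof. by exists 1; rewrite // mul1r. Qed.

Lemma principal_min I x : ideal I -> I x -> principal x `<=` I.
Proof. by move=> iI Ix _ [k _ <-]; apply: idealM. Qed.

(** With one factor of a product fixed, this reduces membership of the product in [K] to generators
    of the ideal containing the other factor. *)
Lemma colonP K x : ideal K -> ideal [set y | K (x * y)].
Proof.
move=> iK; apply/idealP; split=> /= [|k u v Ku Kv].
  by rewrite mulr0; exact: ideal0.
by rewrite mulrDr mulrCA; exact: (idealD iK (idealM k iK Ku) Kv).
Qed.

Lemma ideal_mulP I J : ideal (ideal_mul I J).
Proof. exact: ideal_genP. Qed.

Lemma ideal_mul_in I J x y : I x -> J y -> ideal_mul I J (x * y).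
Proof. by move=> Ix Jy; apply: sub_ideal_gen; exists x => //; exists y. Qed.

Lemma ideal_mul_min I J K : ideal K ->
  (forall x y, I x -> J y -> K (x * y)) -> ideal_mul I J `<=` K.
Proof.
by move=> iK IJK; apply: ideal_gen_min => // _ [x Ix [y Jy <-]]; apply: IJK.
Qed.

Lemma ideal_mulS I I' J J' :
  I `<=` I' -> J `<=` J' -> ideal_mul I J `<=` ideal_mul I' J'.
Proof.
move=> II' JJ'; apply: ideal_mul_min; first exact: ideal_mulP.
by move=> x y /II' ? /JJ' ?; apply: ideal_mul_in.
Qed.

Lemma ideal_mulC I J : ideal_mul I J = ideal_mul J I.
Proof.
apply/seteqP; split; apply: ideal_mul_min; try exact: ideal_mulP;
  by move=> x y ? ?; rewrite mulrC; apply: ideal_mul_in.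
Qed.

Lemma ideal_mulA I J K :
  ideal_mul I (ideal_mul J K) = ideal_mul (ideal_mul I J) K.
Proof.
apply/seteqP; split; apply: ideal_mul_min; try exact: ideal_mulP; move=> x y.
  move=> Ix; move: y; apply: ideal_mul_min; first exact/colonP/ideal_mulP.
  by move=> y z Jy Kz /=; rewrite mulrA; do 2!apply: ideal_mul_in => //.
move=> IJx Ky; rewrite mulrC; move: x IJx.
suff H : ideal_mul I J `<=` [set x | ideal_mul I (ideal_mul J K) (y * x)].
  exact: H.
apply: ideal_mul_min; first exact/colonP/ideal_mulP.
by move=> x z Ix Jz /=;
  rewrite mulrCA [y * z]mulrC; do 2!apply: ideal_mul_in => //.
Qed.

Lemma ideal_mul1l I : ideal I -> ideal_mul setT I = I.
Proof.
move=> iI; apply/seteqP; split=> [|x Ix].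
  by apply: ideal_mul_min => // x y _ Iy; apply: idealM.
by rewrite -[x]mul1r; apply: ideal_mul_in.
Qed.

Lemma ideal_mul_subr I J : ideal J -> ideal_mul I J `<=` J.
Proof. by move=> iJ; apply: ideal_mul_min => // x y _ Jy; apply: idealM. Qed.

Lemma ideal_mulDl I J K : ideal I -> ideal J ->
  ideal_mul (ideal_add I J) K `<=` ideal_add (ideal_mul I K) (ideal_mul J K).
Proof.
move=> iI iJ; have iIJ := ideal_addP (ideal_mulP I K) (ideal_mulP J K).
apply: ideal_mul_min => // z k [x Ix Jzx] Kk.
exists (x * k); first exact: ideal_mul_in.
by rewrite -mulrBl; apply: ideal_mul_in.
Qed.

Lemma ideal_exp_ideal I n : ideal (ideal_exp I n).
Proof. by case: n => [|n]; [exact: idealT|exact: ideal_mulP]. Qed.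

Lemma ideal_expS I n : ideal_exp I n.+1 = ideal_mul I (ideal_exp I n).
Proof. by []. Qed.

Lemma ideal_expD I m n :
  ideal_exp I (m + n) = ideal_mul (ideal_exp I m) (ideal_exp I n).
Proof.
elim: m => [|m IH]; first by rewrite ideal_mul1l //; exact: ideal_exp_ideal.
by rewrite addSn !ideal_expS IH ideal_mulA.
Qed.

Lemma ideal_exp_mul I J n :
  ideal_exp (ideal_mul I J) n = ideal_mul (ideal_exp I n) (ideal_exp J n).
Proof.
elim: n => [|n IH]; first by rewrite ideal_mul1l //; exact: idealT.
rewrite !ideal_expS IH -!ideal_mulA; congr ideal_mul.
by rewrite !ideal_mulA (ideal_mulC J).
Qed.

Lemma ideal_expM I m n : ideal_exp (ideal_exp I m) n = ideal_exp I (m * n).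
Proof.
elim: n => [|n IH]; first by rewrite muln0.
by rewrite ideal_expS IH mulnS ideal_expD.
Qed.

Lemma ideal_exp_le I m n : (m <= n)%N -> ideal_exp I n `<=` ideal_exp I m.
Proof.
move=> /subnK <-; rewrite ideal_expD.
by apply: ideal_mul_subr; exact: ideal_exp_ideal.
Qed.

Lemma ideal_exp_in I n x : I x -> ideal_exp I n (x ^+ n).
Proof.
move=> Ix; elim: n => // n IH.
by rewrite exprS; apply: ideal_mul_in.
Qed.

End Ideals.

(** * Powers of a finitely generated ideal through monomials in its generators *)

Section Monomials.
Variables (R : comNzRingType) (r : nat) (g : 'I_r -> R).

Definition monomial (k : 'I_r -> nat) : R := \prod_i g i ^+ k i.

Lemma monomialM (k l : 'I_r -> nat) :
  monomial (fun i => k i + l i)%N = monomial k * monomial l.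
Proof.
by rewrite /monomial -big_split /=; apply: eq_bigr => i _; rewrite exprD.
Qed.

Lemma monomial_exp (k : 'I_r -> nat) :
  ideal_exp (ideal_gen (range g)) (\sum_i k i) (monomial k).
Proof.
rewrite /monomial; apply: (big_ind2 (ideal_exp (ideal_gen (range g)))) => //.
  by move=> d x d' x' Hx Hx'; rewrite ideal_expD; apply: ideal_mul_in.
by move=> i _; apply: ideal_exp_in; apply: sub_ideal_gen; exists i.
Qed.

(** Induction on [n] for all ideals [K] at once: a product [x * y] lies in [K] as soon as [y] lies
    in the colon ideal of [K] by [x], to which the induction hypothesis applies. *)
Lemma ideal_exp_gen (n : nat) (K : set R) : ideal K ->
  (forall k : 'I_r -> nat, (\sum_i k i)%N = n -> K (monomial k)) ->
  ideal_exp (ideal_gen (range g)) n `<=` K.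
Proof.
elim: n K => [|n IH] K iK HK.
  move=> x _; rewrite -[x]mulr1; apply: idealM => //.
  have <- : monomial (fun=> 0%N) = 1.
    by rewrite /monomial big1 // => i _; rewrite expr0.
  by apply: HK; rewrite big1.
apply: ideal_mul_min => // x y gx; move: y; apply: IH; first exact: colonP.
move=> k kn /=; rewrite mulrC.
suff H : ideal_gen (range g) `<=` [set z | K (monomial k * z)].
  exact: (H x gx).
apply: ideal_gen_min; first exact: colonP.
move=> z [i _ <-{z}] /=.
have -> : g i = monomial (fun j => (j == i) : nat).
  rewrite /monomial (bigD1 i) //= eqxx big1 ?mulr1 // => j /negbTE ->.
  by rewrite expr0.
rewrite -monomialM; apply: HK.
by rewrite big_split /= kn (bigD1 i) //= eqxx big1 ?addn1 // => j /negbTE ->.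
Qed.

(* Pigeonhole: dividing by q each exponent of a monomial of degree            *)
(* (n + r - 1) q leaves remainders of total degree at most r (q - 1).         *)
Lemma ideal_exp_frobenius_power (n q : nat) (K : set R) :
  (0 < r)%N -> (0 < q)%N -> ideal K ->
  (forall h, ideal_exp (ideal_gen (range g)) n h -> K (h ^+ q)) ->
  ideal_exp (ideal_gen (range g)) ((n + r - 1) * q) `<=` K.
Proof.
move=> r0 q0 iK HK; apply: ideal_exp_gen => // k kn.
have -> : monomial k =
    monomial (fun i => k i %/ q)%N ^+ q * monomial (fun i => k i %% q)%N.
  rewrite -prodrXl -big_split /=; apply: eq_bigr => i _.
  by rewrite -exprM -exprD -divn_eq.
apply: idealMC => //; apply: HK; apply: ideal_exp_le (monomial_exp _).
have: (\sum_i k i <= (\sum_i k i %/ q) * q + r * q.-1)%N.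
  rewrite big_distrl /= -[r in (r * _)%N]card_ord -sum_nat_const -big_split /=.
  apply: leq_sum => i _; rewrite {1}(divn_eq (k i) q) leq_add2l.
  by rewrite -ltnS prednK // ltn_mod.
rewrite kn; set S := (\sum_i _)%N; case: (leqP n S) => // Sn.
(* If S were at most n - 1, the degree would be at most (n-1)q + r(q-1) = (n+r-1)q - r, which is too
   small since r > 0. *)
have : (S * q <= n.-1 * q)%N.
  by rewrite leq_mul2r -ltnS prednK ?Sn ?orbT // (leq_ltn_trans _ Sn).
move: S Sn => S Sn {kn}.
by case: n Sn => // n _; case: q q0 => // q _ /=; case: r r0 => // r' _; nia.
Qed.

End Monomials.

(** * Consequences of the Noetherian condition *)

Section Noetherian.
Variable R : comNzRingType.
Hypothesis R_noeth : noetherian R.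

Lemma noetherian_gens (I : set R) : ideal I ->
  exists r, exists g : 'I_r -> R, I = ideal_gen (range g).
Proof.
move=> /R_noeth[s ->]; exists (size s), (fun i => nth 0 s i).
congr ideal_gen; apply/seteqP; split=> x /=.
  move=> xs; have ix : (index x s < size s)%N by rewrite index_mem.
  by exists (Ordinal ix); rewrite //= nth_index.
by move=> [i _ <-]; apply: mem_nth.
Qed.

(** Without a maximal member, choice yields a strictly increasing chain in [P]. Its union is a
    finitely generated ideal whose generators all lie in one term, so the chain stops there. *)
Lemma noetherian_max (P : set (set R)) (I : set R) :
    (forall J, P J -> ideal J) -> P I ->
  exists2 L, P L & forall J, P J -> L `<=` J -> J = L.
Proof.
move=> Pid PI; apply: contrapT => noL.
have /choice[f fP] : forall J, exists J', P J -> [/\ P J', J `<=` J' & J' <> J].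
  move=> J; have [PJ|nPJ] := pselect (P J); last by exists J.
  apply: contrapT => noJ; apply: noL; exists J => // J' PJ' JJ'.
  by apply: contrapT => nJ; apply: noJ; exists J'.
pose u n := iter n f I.
have Pu n : P (u n) by elim: n => // n IH; case: (fP _ IH).
have uS n : u n `<=` u n.+1 by case: (fP _ (Pu n)).
have u_le i j : (i <= j)%N -> u i `<=` u j.
  by move=> /subnK <-; elim: (j - i)%N => // k IH x ux; apply/uS/IH.
pose U : set R := [set x | exists n, u n x].
have iU : ideal U.
  apply/idealP; split=> [|k x y [i ux] [j uy]].
    by exists 0%N; exact: ideal0 (Pid _ PI).
  exists (maxn i j); have iu := Pid _ (Pu (maxn i j)).
  apply: idealD => //; first apply: idealM => //.
    exact: u_le (leq_maxl i j) _ ux.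
  exact: u_le (leq_maxr i j) _ uy.
have [r [g Ug]] := noetherian_gens iU.
have /choice[d dP] : forall i, exists n, u n (g i).
  by move=> i; have : U (g i) by rewrite Ug; apply: sub_ideal_gen; exists i.
pose n := (\max_i d i)%N.
have Uu : U `<=` u n.
  rewrite Ug; apply: ideal_gen_min; first exact/Pid/Pu.
  by move=> _ [i _ <-]; apply: u_le (dP i); apply: leq_bigmax.
have [_ _] := fP _ (Pu n); apply; apply/seteqP; split; last exact: uS.
by move=> x ux; apply: Uu; exists n.+1.
Qed.

Lemma ideal_exp_sub_of_pow (m L : set R) : ideal m -> ideal L ->
  (forall y, m y -> exists t, L (y ^+ t)) -> exists t, ideal_exp m t `<=` L.
Proof.
move=> im iL nilp; have [r [g mg]] := noetherian_gens im.
have /choice[d dP] : forall i, exists t, L (g i ^+ t).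
  by move=> i; apply: nilp; rewrite mg; apply: sub_ideal_gen; exists i.
(* A monomial of degree r t + 1 in r variables has some exponent at least t. *)
pose t := (\max_i d i)%N; exists (r * t).+1; rewrite mg.
apply: ideal_exp_gen => // k kS.
have [i di] : exists i, (t <= k i)%N.
  apply: contrapT => noi; have : (\sum_i k i <= \sum_(i < r) t)%N.
    apply: leq_sum => i _; rewrite leqNgt; apply/negP => tk.
    by apply: noi; exists i; exact: ltnW.
  by rewrite kS sum_nat_const card_ord ltnn.
rewrite /monomial (bigD1 i) //=. apply: idealMC => //.
by rewrite -(subnK (leq_trans (leq_bigmax i) di)) exprD; apply: idealM.
Qed.

(** * Noetherian local rings: the theorems of Krull and Chevalley *)

Section Local.
Variable m : set R.
Hypotheses (m_max : maximal_ideal m)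
  (m_uniq : forall m', maximal_ideal m' -> m' = m).

Let im : ideal m. Proof. by case: m_max. Qed.
Let m1 : ~ m 1. Proof. by case: m_max. Qed.

(** Otherwise [x] generates a proper ideal; an ideal maximal among the proper ones containing it is
    a maximal ideal, hence equal to [m], and contains [x]. *)
Lemma local_unit x : ~ m x -> exists y, y * x = 1.
Proof.
move=> mx; apply: contrapT => nox.
have [||L [[iL L1] xL] Lmax] := @noetherian_max
    [set J | (ideal J /\ ~ J 1) /\ principal x `<=` J] (principal x).
- by move=> J [[]].
- split=> //; split; first exact: principalP.
  by move=> [y _ yx]; apply: nox; exists y.
suff Lm : maximal_ideal L.
  by apply: mx; rewrite -(m_uniq Lm); apply/xL/principal_id.
split=> // J iJ J1 LJ; apply: Lmax => //; split=> //; exact: subset_trans LJ.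
Qed.

(* A form of the Artin-Rees argument: take L maximal among the ideals meeting *)
(* N = I + Rx in I + mx; then some power of m lies in L, hence N in I + mx.   *)
Lemma krull_intersection (I : set R) x : ideal I ->
  (forall k, ideal_add I (ideal_exp m k) x) -> I x.
Proof.
move=> iI xI; pose N := ideal_add I (principal x).
have iN : ideal N by apply: ideal_addP => //; exact: principalP.
pose mx : set R := [set y * x | y in m].
have imx : ideal mx.
  apply/idealP; split=> [|k _ _ [y my <-] [z mz <-]].
    by exists 0; rewrite ?mul0r //; exact: ideal0.
  exists (k * y + z); last by rewrite mulrDl mulrA.
  exact: (idealD im (idealM k im my) mz).
pose D := ideal_add I mx.
have iD : ideal D by exact: ideal_addP.
have DN : D `<=` N.
  apply: ideal_add_min => //; first exact/ideal_addl/principalP.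
  by move=> _ [y _ <-]; apply: ideal_addr => //; exists y.
have mND y w : m y -> N w -> D (y * w).
  move=> my [i Ii [k _ kx]]; rewrite -(subrK i w) -kx mulrDr.
  apply: idealD => //; last by apply: idealM => //; apply: ideal_addl.
  by apply: ideal_addr => //; exists (y * k); rewrite ?mulrA //; apply: idealMC.
have [||L [iL LN] Lmax] := @noetherian_max
    [set L | ideal L /\ L `&` N = D] D.
- by move=> J [].
- by split=> //; apply/seteqP; split=> [y []|y Dy] //; split=> //; exact: DN.
have DL : D `<=` L by rewrite -LN => y [].
have [t tL] : exists t, ideal_exp m t `<=` L.
  apply: ideal_exp_sub_of_pow => // y my.
  (* The colon ideals of L by the powers of y increase, so they become stationary at some exponent
     t. *)
  have [||_ [t ->] tmax] := @noetherian_max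
      [set C | exists t, C = [set z | L (y ^+ t * z)]] [set z | L (y ^+ 0 * z)].
  - by move=> _ [t ->]; exact: colonP.
  - by exists 0%N.
  have tS z : L (y ^+ t.+1 * z) -> L (y ^+ t * z).
    have E : [set z | L (y ^+ t.+1 * z)] = [set z | L (y ^+ t * z)].
      apply: tmax; first by exists t.+1.
      by move=> w /= Lw; rewrite exprS -mulrA; apply: idealM.
    by move=> Lz; have : [set z | L (y ^+ t.+1 * z)] z by []; rewrite E.
  (* L' also meets N in D, so maximality of L forces y^t into L. Indeed, if w = l + k y^t lies in N,
     then y w lies in mN, hence in D, so k y^(t+1) lies in L and therefore so does k y^t. *)
  exists t; pose L' := ideal_add L (principal (y ^+ t)).
  have iL' : ideal L' by apply: ideal_addP => //; exact: principalP.
  have LL' : L `<=` L' by exact/ideal_addl/principalP.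
  suff <- : L' = L by apply: ideal_addr => //; exact: principal_id.
  apply: Lmax => //; split=> //; apply/seteqP; split=> w; last first.
    by move=> Dw; split; [apply/LL'/DL|apply: DN].
  move=> [[l Ll [k _ kE]] Nw]; rewrite -LN; split=> //.
  rewrite -(subrK l w) -kE; apply: idealD => //; rewrite mulrC; apply: tS.
  rewrite exprS -mulrA [_ * k]mulrC kE mulrBr; apply: idealB => //.
    exact/DL/mND.
  exact: idealM.
have [i Ii [y my yx]] : D x.
  rewrite -LN; split; last by apply: ideal_addr => //; exact: principal_id.
  apply: ideal_add_min (xI t) => //.
  by move=> z Iz; apply/DL/ideal_addl.
(* Now x - y x lies in I with y in m, and 1 - y is a unit. *)
have [|z zy] := @local_unit (1 - y).
  by move=> my1; apply: m1; rewrite -(subrK y 1); apply: idealD.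
rewrite -[x]mul1r -zy -mulrA mulrBl mul1r yx subKr.
exact: idealM.
Qed.

Definition filtered (F : set (set R)) : Prop :=
  forall D D', F D -> F D' -> exists2 D'', F D'' & D'' `<=` D `&` D'.

(** The descending chain condition for R/A. In a filtered family a minimal member is a least one,
    which is the form that Chevalley's argument uses. *)
Definition artinian_above (A : set R) : Prop :=
  forall F : set (set R), (exists D, F D) ->
    (forall D, F D -> ideal D /\ A `<=` D) -> filtered F ->
  exists2 D0, F D0 & forall D, F D -> D0 `<=` D.

(** Noetherian induction: take a counterexample [A] maximal among ideals containing m^j and enlarge
    it to B = A + Rf, where f is a socle element modulo [A]. Passing from [A] to [B] costs only a
    module of length one. *)
Lemma local_artinian_above (j : nat) (A0 : set R) :
  ideal A0 -> ideal_exp m j `<=` A0 -> artinian_above A0.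
Proof.
move=> iA0 jA0; apply: contrapT => nA0.
have [||A [iA jA nA] Amax] := @noetherian_max [set A |
    [/\ ideal A, ideal_exp m j `<=` A & ~ artinian_above A]] A0.
- by move=> J [].
- by [].
apply: nA => F [D1 FD1] FA Ffil.
have [A1|nA1] := pselect (A 1).
  exists D1 => // D /FA[iD AD].
  by rewrite (ideal_full iD) //; exact: AD.
have exj : exists i, `[< ideal_exp m i `<=` A >] by exists j; apply/asboolP.
have [f Af mfA] : exists2 f, ~ A f & forall y, m y -> A (y * f).
  (* With i + 1 the least exponent whose power of m lies in A, any f in m^i outside A is killed by m
     modulo A. Exponent 0 would make A the unit ideal. *)
  case: (ex_minnP exj) => -[|i] /asboolP iA' imin.
    by exfalso; apply: nA1; apply: iA'.
  have : ~ ideal_exp m i `<=` A by move/asboolP => /imin; rewrite ltnn.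
  move=> /existsNP[f /not_implyP[fi Af]]; exists f => // y my.
  by apply: iA'; apply: ideal_mul_in.
pose B := ideal_add A (principal f).
have iB : ideal B by apply: ideal_addP => //; exact: principalP.
have AB : A `<=` B by exact/ideal_addl/principalP.
have dccB : artinian_above B.
  apply: contrapT => nB; apply: Af.
  rewrite -(Amax B) //; first by apply: ideal_addr => //; exact: principal_id.
  by split=> //; exact: subset_trans AB.
have [[D2 FD2 nf]|allf] := pselect (exists2 D, F D & ~ D f); last first.
  apply: dccB => //; first by exists D1.
  move=> D FD; have [iD AD] := FA _ FD; split=> //.
  apply: ideal_add_min => //; apply: principal_min => //.
  by apply: contrapT => Df; apply: allf; exists D.
have [|||_ [D3 FD3 <-] D3min] := dccB [set ideal_add D B | D in F].
- by exists (ideal_add D1 B), D1.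
- move=> _ [D /FA[iD _] <-]; split; first exact: ideal_addP.
  exact: ideal_addr.
- move=> _ _ [D FD <-] [D' FD' <-].
  have [D'' FD'' DD] := Ffil _ _ FD FD'.
  exists (ideal_add D'' B); first by exists D''.
  by move=> z [x /DD[Dx D'x] Bx]; split; exists x.
(* D0 avoids f and is least modulo B. A v in D0 is d + a + k f with d in D' and a in A, so k f lies
   in D0; k cannot be a unit, whence k f lies in A. *)
have [D0 FD0 D0sub] := Ffil _ _ FD2 FD3.
exists D0 => // D FD; have [D' FD' D'sub] := Ffil _ _ FD FD0.
suff D0D' : D0 `<=` D' by move=> x /D0D' /D'sub[].
have [iD0 AD0] := FA _ FD0; have [iD' AD'] := FA _ FD'.
move=> v D0v.
have [d D'd [a Aa [k _ kf]]] : ideal_add D' B v.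
  apply: (D3min (ideal_add D' B)); first by exists D'.
  by apply: ideal_addl => //; case: (D0sub _ D0v).
have D0d : D0 d by case: (D'sub _ D'd).
have D0kf : D0 (k * f).
  by rewrite kf; apply: idealB => //; [exact: idealB|exact: AD0].
rewrite -(subrK d v); apply: idealD => //; rewrite -(subrK a (v - d)) -kf.
apply: idealD => //; last exact: AD'.
have [mk|nk] := pselect (m k); first exact/AD'/mfA.
exfalso; apply: nf; have [z zk] := local_unit nk.
have /D0sub[] // : D0 f.
by rewrite -[f]mul1r -zk -mulrA; apply: idealM.
Qed.

(** Modulo each m^j the family has a least member [d j]. An x in [d k] is lifted successively to
    elements of [d (k + n)] agreeing modulo m^(k+n); the limit is congruent to x modulo m^k and lies
    in every D by Krull's theorem. *)
Lemma chevalley (m_compl : adically_complete m) (F : set (set R)) (k : nat) :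
    (exists D, F D) -> (forall D, F D -> ideal D) -> filtered F ->
  exists2 D, F D &
    D `<=` ideal_add [set x | forall D', F D' -> D' x] (ideal_exp m k).
Proof.
move=> [D1 FD1] Fid Ffil.
have imj := @ideal_exp_ideal R m.
have /choice[d dP] j : exists D, F D /\ forall D', F D' ->
    ideal_add D (ideal_exp m j) `<=` ideal_add D' (ideal_exp m j).
  have [|||_ [D FD <-] Dmin] := @local_artinian_above j (ideal_exp m j) (imj j)
      (@subset_refl _ _) [set ideal_add D (ideal_exp m j) | D in F].
  - by exists (ideal_add D1 (ideal_exp m j)), D1.
  - move=> _ [D FD <-]; split; first by apply: ideal_addP => //; exact: Fid.
    exact/ideal_addr/Fid.
  - move=> _ _ [D FD <-] [D' FD' <-].
    have [D'' FD'' DD] := Ffil _ _ FD FD'.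
    exists (ideal_add D'' (ideal_exp m j)); first by exists D''.
    by move=> z [x /DD[Dx D'x] Bx]; split; exists x.
  by exists D; split=> // D' FD'; apply: Dmin; exists D'.
exists (d k) => [|x dx]; first by case: (dP k).
(* One lifting step from level j to level j + 1, with the junk value 0 when y is not in d j +
   m^j. *)
have /choice[f fP] : forall jy : nat * R, exists z,
    ideal_add (d jy.1) (ideal_exp m jy.1) jy.2 ->
    d jy.1.+1 z /\ ideal_exp m jy.1 (z - jy.2).
  move=> [j y] /=.
  have [dy|ndy] := pselect (ideal_add (d j) (ideal_exp m j) y); last by exists 0.
  have [FS _] := dP j.+1; have [_ /(_ _ FS) /(_ _ dy)[z dz mz]] := dP j.
  by exists z => _; split=> //; rewrite -opprB; apply: idealN.
pose fix v n := if n is n'.+1 then f ((k + n')%N, v n') else x.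
have dv n : d (k + n)%N (v n).
  elim: n => [|n IH]; first by rewrite addn0.
  rewrite addnS; exact: (fP ((k + n)%N, v n) (ideal_addl (imj _) IH)).1.
have vS n : ideal_exp m (k + n) (v n.+1 - v n).
  exact: (fP ((k + n)%N, v n) (ideal_addl (imj _) (dv n))).2.
(* Completeness requires the n-th difference to lie in m^n, hence the shift by k; truncated
   subtraction keeps the sequence equal to x up to index k. *)
have [|l [lP _]] := m_compl (fun n => v (n - k)%N).
  move=> n; have [kn|nk] := leqP k n.
    by rewrite subSn //; have := vS (n - k)%N; rewrite subnKC.
  have -> : (n.+1 - k = 0)%N by apply/eqP.
  have -> : (n - k = 0)%N by apply/eqP; exact: ltnW.
  by rewrite subrr; exact: ideal0.
exists l; last by have := lP k; rewrite subnn.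
move=> D FD; apply: krull_intersection; first exact: Fid.
move=> j; have iD := Fid _ FD.
have iDm : ideal (ideal_add D (ideal_exp m j)) by exact: ideal_addP.
have kj : ideal_exp m (k + j) `<=` ideal_exp m j.
  by apply: ideal_exp_le; exact: leq_addl.
have := lP (k + j)%N; rewrite addKn => /kj vl.
rewrite -(subKr (v j) l); apply: idealB => //; last exact: ideal_addr.
have [_ /(_ _ FD) sub] := dP (k + j)%N.
have [y Dy my] := sub _ (ideal_addl (imj _) (dv j)).
by exists y => //; exact: kj.
Qed.

End Local.

End Noetherian.

(** * Quotient of a module by a submodule *)

Section QuotientModule.
Variables (R : comNzRingType) (M : lmodType R) (N : submodClosed M).

(* [submodClosed] does not record closure under opposites, which            *)
(* [Quotient.quot] requires.                                                *)
Definition submod_pred : {pred M} := N.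

Lemma submod_pred_zmod : zmod_closed submod_pred.
Proof.
split=> [|x y Nx Ny]; first exact: rpred0.
by rewrite -scaleN1r; apply: rpredD => //; apply: rpredZ.
Qed.
HB.instance Definition _ :=
  GRing.isZmodClosed.Build M submod_pred submod_pred_zmod.

Definition quotmod : Type := Quotient.quot submod_pred.
HB.instance Definition _ := GRing.Zmodule.on quotmod.

Definition to_quot (x : M) : quotmod := (\pi_(Quotient.quot submod_pred) x)%qT.

Lemma to_quotP (t : quotmod) : exists x, t = to_quot x.
Proof.
by exists (repr (t : Quotient.quot submod_pred)); rewrite /to_quot reprK.
Qed.

Lemma to_quot_eq x y : to_quot x = to_quot y <-> x - y \in N.
Proof.
rewrite -[_ \in _]/(x - y \in submod_pred) Quotient.idealrBE.
by split=> [/eqP|/eqP].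
Qed.

Lemma to_quotB : {morph to_quot : x y / x - y}.
Proof. exact: raddfB. Qed.

Let scale (k : R) (t : quotmod) : quotmod :=
  to_quot (k *: repr (t : Quotient.quot submod_pred)).

Let scale_to k x : scale k (to_quot x) = to_quot (k *: x).
Proof.
apply/to_quot_eq; rewrite -scalerBr; apply/rpredZ/to_quot_eq.
by rewrite /to_quot reprK.
Qed.

Let to_quotD x y : to_quot x + to_quot y = to_quot (x + y).
Proof. by rewrite [RHS]raddfD. Qed.

Let scaleA a b t : scale a (scale b t) = scale (a * b) t.
Proof. by have [x ->] := to_quotP t; rewrite !scale_to scalerA. Qed.
Let scale1 : left_id 1 scale.
Proof. by move=> t; have [x ->] := to_quotP t; rewrite scale_to scale1r. Qed.
Let scaleDr : right_distributive scale +%R.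
Proof.
move=> a s t; have [x ->] := to_quotP s; have [y ->] := to_quotP t.
by rewrite to_quotD !scale_to scalerDr to_quotD.
Qed.
Let scaleDl t : {morph scale^~ t : a b / a + b}.
Proof.
by move=> a b; have [x ->] := to_quotP t; rewrite !scale_to scalerDl to_quotD.
Qed.

HB.instance Definition _ := GRing.Zmodule_isLmodule.Build R quotmod
  scaleA scale1 scaleDr scaleDl.

HB.instance Definition _ :=
  GRing.isZmodMorphism.Build M quotmod to_quot to_quotB.

Lemma to_quotZ : scalable to_quot.
Proof. by move=> k x; symmetry; exact: scale_to. Qed.
HB.instance Definition _ :=
  GRing.isScalable.Build R M quotmod *:%R to_quot to_quotZ.

Lemma to_quot_eq0 x : to_quot x = 0 <-> x \in N.
Proof. by rewrite -(raddf0 to_quot) to_quot_eq subr0. Qed.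

End QuotientModule.

(** * Finite generation of quotients, products and finite powers *)

Section FinGen.
Variable R : comNzRingType.

(** An induction principle: it avoids explicit linear combinations and transfers along linear maps
    by preimages of submodules. *)
Lemma fin_genP (M : lmodType R) :
  fin_gen M <-> exists s : seq M, forall N : set M, submod_closed [in N] ->
    [set` s] `<=` N -> forall x, N x.
Proof.
split=> -[s sM]; exists s.
  move=> N iN sN x; have : Defs.span [set` s] x by rewrite sM.
  exact: span_min.
apply/seteqP; split=> // x _.
by apply: sM; [exact: span_submod|exact: subset_span].
Qed.

Lemma preim_submod (M M' : lmodType R) (f : {linear M -> M'}) (N : set M') :
  submod_closed [in N] -> submod_closed [in f @^-1` N].
Proof.
move=> /submod_setP[N0 NP]; apply/submod_setP; split=> [|k u v Nu Nv] /=.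
  by rewrite linear0.
by rewrite linearP; apply: NP.
Qed.

Lemma fin_gen_quotmod (M : lmodType R) (N : submodClosed M) :
  fin_gen M -> fin_gen (quotmod N).
Proof.
move=> /fin_genP[s sM]; apply/fin_genP; exists (map (@to_quot R M N) s).
move=> K iK sK t; have [x ->] := to_quotP t.
apply: (sM (to_quot N @^-1` K)); first exact: (@preim_submod _ _ (to_quot N)).
by move=> y ys /=; apply: sK => /=; apply: map_f.
Qed.

Lemma fin_gen_ring : fin_gen R^o.
Proof.
apply/fin_genP; exists [:: 1 : R^o] => N iN sN x.
by rewrite (ideal_full iN) //; apply: sN; rewrite /= inE.
Qed.

Section PairInjections.
Variables M M' : lmodType R.

Definition pair_inl (x : M) : (M * M')%type := (x, 0).
Definition pair_inr (y : M') : (M * M')%type := (0, y).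

Lemma pair_inl_linear : linear pair_inl.
Proof. by move=> k x y; congr pair; rewrite /= scaler0 addr0. Qed.
HB.instance Definition _ :=
  GRing.isLinear.Build R M (M * M')%type *:%R pair_inl pair_inl_linear.

Lemma pair_inr_linear : linear pair_inr.
Proof. by move=> k x y; congr pair; rewrite /= scaler0 addr0. Qed.
HB.instance Definition _ :=
  GRing.isLinear.Build R M' (M * M')%type *:%R pair_inr pair_inr_linear.

Lemma pair_inE (x : M) (y : M') : (x, y) = pair_inl x + pair_inr y.
Proof. by congr pair; rewrite /= ?addr0 ?add0r. Qed.

Lemma fin_gen_prod : fin_gen M -> fin_gen M' -> fin_gen (M * M')%type.
Proof.
move=> /fin_genP[s sM] /fin_genP[s' sM']; apply/fin_genP.
exists (map pair_inl s ++ map pair_inr s') => N iN sN [x y].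
have Nx : N (pair_inl x).
  apply: (sM (pair_inl @^-1` N)) => [|z zs /=]; first exact: preim_submod.
  by apply: sN; rewrite /= mem_cat map_f.
have Ny : N (pair_inr y).
  apply: (sM' (pair_inr @^-1` N)) => [|z zs /=]; first exact: preim_submod.
  by apply: sN; rewrite /= mem_cat map_f ?orbT.
move: iN => /submod_setP[_ NP].
by rewrite pair_inE -[pair_inl x]scale1r; exact: NP.
Qed.

End PairInjections.

Definition ffun_single (s : nat) (M : lmodType R) (i : 'I_s) (x : M) :
  {ffun 'I_s -> M} := [ffun j => if j == i then x else 0].

Lemma ffun_single_linear s (M : lmodType R) i : linear (@ffun_single s M i).
Proof.
move=> k x y; apply/ffunP => j; rewrite !ffunE.
by case: eqP => // _; rewrite scaler0 addr0.
Qed.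
HB.instance Definition _ s (M : lmodType R) i :=
  GRing.isLinear.Build R M {ffun 'I_s -> M} *:%R (@ffun_single s M i)
    (@ffun_single_linear s M i).

Lemma ffun_singleE s (M : lmodType R) (f : {ffun 'I_s -> M}) :
  f = \sum_i ffun_single i (f i).
Proof.
apply/ffunP => j; rewrite sum_ffunE (bigD1 j) //= ffunE eqxx big1 ?addr0 //.
by move=> i /negbTE ij; rewrite ffunE eq_sym ij.
Qed.

Lemma fin_gen_ffun (s : nat) (M : lmodType R) :
  fin_gen M -> fin_gen {ffun 'I_s -> M}.
Proof.
move=> /fin_genP[t tM]; apply/fin_genP.
exists [seq ffun_single i x | i <- enum 'I_s, x <- t].
move=> N /[dup] iN /submod_setP[N0 NP] tN f.
rewrite (ffun_singleE f); apply: (big_ind N) => // [u v Nu Nv|i _].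
  by rewrite -[u]scale1r; exact: NP.
apply: (tM (ffun_single i @^-1` N)) => [|x xt /=].
  exact: (@preim_submod _ _ (ffun_single i)).
by apply: tN => /=; apply: allpairs_f; rewrite ?mem_enum.
Qed.

End FinGen.

(** * Functoriality of base change *)

Lemma base_change_ind (R S : comNzRingType) (phi : {rmorphism R -> S})
    (M : lmodType R) (P : base_change phi M -> Prop) :
  P 0 -> (forall s m, P (pure s m)) ->
  (forall x y, P x -> P y -> P (x - y)) -> forall t, P t.
Proof.
move=> P0 Ppure PB; apply: tensor_ind => // s m t Pt.
  rewrite addrC -[pure s m]opprK -[- pure s m]sub0r.
  exact: (PB t _ Pt (PB _ _ P0 (Ppure s m))).
by rewrite addrC; exact: (PB t _ Pt (Ppure s m)).
Qed.

Section BaseChange.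
Variables (R S : comNzRingType) (phi : {rmorphism R -> S}).
Variables (N M : lmodType R) (f : {linear N -> M}).

Let B (s : restr phi) (n : N) : base_change phi M := pure s (f n).
Let BDl n : {morph B^~ n : a b / a + b}.
Proof. by move=> a b; exact: pureDl. Qed.
Let BDr a : {morph B a : m n / m + n}.
Proof. by move=> m n; rewrite /B raddfD; exact: pureDr. Qed.
Let BZ k a n : B (k *: a) n = B a (k *: n).
Proof. by rewrite /B linearZ; exact: pureZ. Qed.

Lemma base_change_map_pure s n :
  base_change_map (phi := phi) f (pure s n) = pure s (f n).
Proof. exact: (tensor_lift_pure BDl BDr BZ). Qed.

Lemma base_change_mapB : {morph base_change_map (phi := phi) f : x y / x - y}.
Proof. exact: (tensor_lift_additive BDl BDr BZ). Qed.

HB.instance Definition _ := GRing.isZmodMorphism.Build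
  (base_change phi N) (base_change phi M) (base_change_map (phi := phi) f)
  base_change_mapB.

Lemma base_change_mapZ : scalable (base_change_map (phi := phi) f).
Proof.
move=> k t; elim/base_change_ind: t => [|s n|x y IHx IHy].
- by rewrite scaler0 raddf0 scaler0.
- by rewrite base_change_scale_pure !base_change_map_pure base_change_scale_pure.
- rewrite (@scalerBr S (base_change phi N)) !base_change_mapB IHx IHy.
  by rewrite (@scalerBr S (base_change phi M)).
Qed.

End BaseChange.

(** * Tight closure of zero and tau as an intersection of annihilators *)

Section TightClosureOfZero.
Variables (R : comNzRingType) (p : nat) (chRp : p \in [pchar R]).

Lemma frobeniusE e x : frobenius chRp e x = x ^+ (p ^ e).
Proof.
elim: e => [|e IH] //=.
by rewrite IH pFrobenius_autE -exprM expnSr.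
Qed.

Lemma frob_eltD e (M : lmodType R) :
  {morph frob_elt chRp e (M := M) : x y / x + y}.
Proof. by move=> x y; exact: pureDr. Qed.

(** Moving k across the tensor sign applies the iterated Frobenius to it. *)
Lemma frob_eltZ e (M : lmodType R) k (z : M) :
  frob_elt chRp e (k *: z) = k ^+ (p ^ e) *: frob_elt chRp e z.
Proof.
rewrite /frob_elt -pureZ -frobeniusE.
by symmetry; exact: base_change_scale_pure.
Qed.

Lemma frob_elt0 e (M : lmodType R) : frob_elt chRp e (0 : M) = 0.
Proof.
by apply: (addrI (frob_elt chRp e (0 : M))); rewrite -frob_eltD !addr0.
Qed.

Lemma frob_map_elt e (M M' : lmodType R) (f : {linear M -> M'}) z :
  frob_map chRp e f (frob_elt chRp e z) = frob_elt chRp e (f z).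
Proof. exact: base_change_map_pure. Qed.

Lemma frob_mapZ e (M M' : lmodType R) (f : {linear M -> M'}) k t :
  frob_map chRp e f (k *: t) = k *: frob_map chRp e f t.
Proof. exact: base_change_mapZ. Qed.

Lemma frob_map0 e (M M' : lmodType R) (f : {linear M -> M'}) :
  frob_map chRp e f 0 = 0.
Proof. by rewrite -(subrr 0) [LHS]base_change_mapB subrr. Qed.

Lemma frob_submod_zero e (M : lmodType R) :
  frob_submod chRp e (@zero_submod R M) = [set 0].
Proof.
apply/seteqP; split=> [_ [t _ <-]|_ ->] /=; last by exists 0; rewrite ?frob_map0.
elim/base_change_ind: t => [|s m|x y Hx Hy]; first exact: frob_map0.
  rewrite [LHS]base_change_map_pure.
  have m0 : (\val : submod_type (@zero_submod R M) -> M) m = 0.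
    by apply/eqP; exact: (valP m).
  rewrite [X in pure _ X]m0; apply: (addrI (pure s (0 : M))).
  by rewrite -pureDr !addr0.
rewrite [LHS]base_change_mapB; apply/eqP; rewrite subr_eq0; apply/eqP.
by rewrite [LHS]Hx [RHS]Hy.
Qed.

Lemma tight_closure_zeroP (b : set R) (M : lmodType R) (z : M) :
  tight_closure chRp b (@zero_submod R M) z <->
  exists2 c, circ c & exists e0, forall e, (e0 <= e)%N ->
    forall x, ideal_exp b (p ^ e) x -> (c * x) *: frob_elt chRp e z = 0.
Proof.
split=> -[c cR [e0 e0P]]; exists c => //; exists e0 => e /e0P.
  by rewrite frob_submod_zero => H x bx; apply: H; exists x.
by rewrite frob_submod_zero => H _ [x /H bx <-].
Qed.

Lemma circ1 : circ (1 : R).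
Proof. by move=> P [[]]. Qed.

Lemma circM (c d : R) : circ c -> circ d -> circ (c * d).
Proof. by move=> cc dd P /[dup] mP [[_ _ PM] _] /PM[/cc|/dd]; apply. Qed.

(** Functoriality of F^e: the same multiplier and the same bound on e serve for the image. *)
Lemma tight_closure_linear (b : set R) (M M' : lmodType R)
    (f : {linear M -> M'}) z :
  tight_closure chRp b (@zero_submod R M) z ->
  tight_closure chRp b (@zero_submod R M') (f z).
Proof.
move=> /tight_closure_zeroP[c cR [e0 e0P]]; apply/tight_closure_zeroP.
exists c => //; exists e0 => e /e0P H x /H bx.
by rewrite -frob_map_elt -frob_mapZ bx frob_map0.
Qed.

Lemma tight_closureD (b : set R) (M : lmodType R) (y z : M) :
  tight_closure chRp b (@zero_submod R M) y ->
  tight_closure chRp b (@zero_submod R M) z ->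
  tight_closure chRp b (@zero_submod R M) (y + z).
Proof.
move=> /tight_closure_zeroP[c cR [e0 e0P]] /tight_closure_zeroP[d dR [f0 f0P]].
apply/tight_closure_zeroP; exists (c * d); first exact: circM.
exists (maxn e0 f0) => e; rewrite geq_max => /andP[/e0P He /f0P Hf] x bx.
rewrite -mulrA frob_eltD scalerDr -[_ *: frob_elt _ _ z]scalerA Hf //.
by rewrite mulrCA -scalerA He // !scaler0 addr0.
Qed.

Lemma tight_closure0 (b : set R) (M : lmodType R) :
  tight_closure chRp b (@zero_submod R M) 0.
Proof.
apply/tight_closure_zeroP; exists 1; first exact: circ1.
by exists 0%N => e _ x _; rewrite frob_elt0 scaler0.
Qed.

Definition ann (M : lmodType R) (z : M) : set R := [set x | x *: z = 0].

Lemma annP (M : lmodType R) (z : M) : ideal (ann z).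
Proof.
rewrite /ann; apply/idealP; split=> [|k x y /= xz yz]; first exact: scale0r.
by rewrite scalerDl -scalerA xz yz scaler0 addr0.
Qed.

(** Annihilators of single elements, not of whole tight closures: the intersection is the same, the
    family is filtered, and each member has the form that the construction of [w] takes as input. *)
Definition tau_anns (b : set R) : set (set R) :=
  [set I | exists M : lmodType R, exists z : M,
    [/\ fin_gen M, tight_closure chRp b (@zero_submod R M) z & I = ann z]].

Lemma tauE b : tau chRp b = [set x | forall I, tau_anns b I -> I x].
Proof.
apply/seteqP; split=> x /= Hx; first by move=> _ [M [z [fM cz ->]]]; apply: Hx.
by move=> M fM z cz; apply: (Hx (ann z)); exists M, z.
Qed.

Lemma tau_anns_ideal b I : tau_anns b I -> ideal I.
Proof. by move=> [M [z [_ _ ->]]]; exact: annP. Qed.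

Lemma tau_ideal b : ideal (tau chRp b).
Proof.
rewrite tauE; apply/idealP; split=> [|k x y xb yb] I Ib.
  exact: ideal0 (tau_anns_ideal Ib).
have iI := tau_anns_ideal Ib.
exact: (idealD iI (idealM k iI (xb _ Ib)) (yb _ Ib)).
Qed.

Lemma tau_annsT b : tau_anns b setT.
Proof.
exists R^o, 0; split; [exact: fin_gen_ring|exact: tight_closure0|].
by apply/seteqP; split=> // x _; exact: scaler0.
Qed.

(** The annihilator of a pair is the intersection of the two annihilators, and the pair is a sum of
    linear images of its components. *)
Lemma tau_anns_filtered b : filtered (tau_anns b).
Proof.
move=> _ _ [M [z [fM cz ->]]] [M' [z' [fM' cz' ->]]].
exists (ann (z, z') : set R); last by move=> x /= [].
exists (M * M')%type, (z, z'); split=> //; first exact: fin_gen_prod.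
rewrite pair_inE; apply: tight_closureD; exact: tight_closure_linear.
Qed.

End TightClosureOfZero.

(* Modulo [root_rels] the class [root_elt] of (1, 0) satisfies h_i w = z e_i. *)
Section RootModule.
Variables (R : comNzRingType) (M : lmodType R) (s : nat) (h : 'I_s -> R) (z : M).

Definition root_rels : {pred (R^o * {ffun 'I_s -> M})%type} :=
  [in [set (\sum_i k i * h i, - [ffun i => k i *: z]) | k in [set: 'I_s -> R]]].

Lemma root_rels_closed : submod_closed root_rels.
Proof.
apply/submod_setP; split=> [|l _ _ [k _ <-] [k' _ <-]].
  exists (fun=> 0) => //; congr pair.
    by rewrite big1 // => i _; rewrite mul0r.
  by apply/ffunP => i; rewrite !ffunE scale0r oppr0.
exists (fun i => l * k i + k' i) => //; congr pair => /=.
  rewrite [l *: _]mulr_sumr -big_split /=; apply: eq_bigr => i _.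
  by rewrite mulrDl mulrA.
apply/ffunP => i; rewrite !ffunE.
by rewrite scalerDl opprD scalerN scalerA.
Qed.
HB.instance Definition _ := GRing.isSubmodClosed.Build R
  (R^o * {ffun 'I_s -> M})%type root_rels root_rels_closed.

Definition root_mod : lmodType R := quotmod root_rels.
Definition root_elt : root_mod := to_quot root_rels (1, 0).
Definition root_inj (i : 'I_s) : {linear M -> root_mod} :=
  (to_quot root_rels \o (@pair_inr R R^o _ \o @ffun_single R s M i)).

Lemma root_modP i : h i *: root_elt = root_inj i z.
Proof.
rewrite /root_elt -to_quotZ; apply/to_quot_eq; rewrite in_setE.
(* The relation whose coefficient vector is the i-th unit vector. *)
exists (fun j => if j == i then 1 else 0) => //; congr pair => /=.
  rewrite (bigD1 i) //= eqxx big1 ?mul1r ?addr0 ?subr0 ?[_ *: _]mulr1 //.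
  by move=> j /negbTE ->; rewrite mul0r.
apply/ffunP => j; rewrite !ffunE scaler0 add0r.
by case: eqP => _; rewrite ?scale1r ?scale0r.
Qed.

(** If x kills the class of (1, 0), then (x, 0) is itself a relation: x = sum k_i h_i with every k_i
    z = 0. *)
Lemma ann_root_elt :
  ann root_elt `<=` ideal_mul (ann z) (ideal_gen (range h)).
Proof.
move=> x /=; rewrite /ann /= /root_elt -to_quotZ => /to_quot_eq0; rewrite in_setE.
case=> k _ [kx /ffunP kz].
have -> : x = \sum_i k i * h i by rewrite kx [_ *: _]mulr1.
apply: (big_ind (ideal_mul (ann z) (ideal_gen (range h)))).
- exact: ideal0 (ideal_mulP _ _).
- by move=> u v; apply: idealD; exact: ideal_mulP.
move=> i _; apply: ideal_mul_in; last by apply: sub_ideal_gen; exists i.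
by move: (kz i); rewrite !ffunE scaler0 => /eqP; rewrite oppr_eq0 => /eqP.
Qed.

Lemma fin_gen_root_mod : fin_gen M -> fin_gen root_mod.
Proof.
move=> fM; apply/fin_gen_quotmod/fin_gen_prod; first exact: fin_gen_ring.
exact: fin_gen_ffun.
Qed.

End RootModule.

(** * The Skoda-type inclusion for a single annihilator *)

Section Skoda.
Variables (R : comNzRingType) (p : nat) (chRp : p \in [pchar R]).
Hypothesis R_noeth : noetherian R.
Variables (r : nat) (g : 'I_r -> R).
Hypothesis r_gt0 : (0 < r)%N.

Let a := ideal_gen (range g).

(** The multiplier and the bound on e that work for z also work for w: each h_i w is a linear image
    of z, and the pigeonhole inclusion reduces a^((n+r-1)q) to q-th powers of elements of a^n. *)
Lemma tight_closure_root (n s : nat) (h : 'I_s -> R) (b : set R)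
    (M : lmodType R) (z : M) :
  ideal_exp a n = ideal_gen (range h) ->
  tight_closure chRp b (@zero_submod R M) z ->
  tight_closure chRp (ideal_mul (ideal_exp a (n + r - 1)) b)
    (@zero_submod R (root_mod h z)) (root_elt h z).
Proof.
move=> ah /tight_closure_zeroP[c cR [e0 e0P]]; apply/tight_closure_zeroP.
exists c => //; exists e0 => e /e0P {e0P} cz y.
set W := frob_elt _ _ _; pose q := (p ^ e)%N.
have q0 : (0 < q)%N by rewrite expn_gt0 prime_gt0 // (pcharf_prime chRp).
have iK k : ideal [set y | (c * (k * y)) *: W = 0].
  apply/idealP; split=> [|l u v /= uW vW]; first by rewrite /= !mulr0 scale0r.
  rewrite !mulrDr scalerDl vW addr0.
  by rewrite (mulrCA k) (mulrCA c) -scalerA uW scaler0.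
rewrite ideal_exp_mul ideal_expM; move: y.
have iK1 : ideal [set y | (c * y) *: W = 0].
  by have := iK 1; congr ideal; apply/funext => y; rewrite /= mul1r.
apply: ideal_mul_min => // u v au bv /=; rewrite [u * v]mulrC; move: u au.
apply: (ideal_exp_frobenius_power r_gt0 q0 (iK v)) => l.
rewrite -/a ah /= mulrA -scalerA -frob_eltZ; move: l.
(* By Frobenius semilinearity the l for which c k kills (l w)^q form an ideal, so only the
   generators h_i need checking. *)
apply: (@ideal_gen_min R _ [set l | _]) => [|_ [i _ <-] /=].
  apply/idealP; split=> [|k l l' /= Hl Hl'].
    by rewrite /= scale0r frob_elt0 scaler0.
  rewrite scalerDl frob_eltD scalerDr Hl' addr0 -[(k * l) *: _]scalerA frob_eltZ.
  by rewrite scalerA [X in X *: _]mulrC -scalerA Hl scaler0.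
by rewrite root_modP -frob_map_elt -frob_mapZ cz // frob_map0.
Qed.

Lemma tau_sub_ann_mul (n : nat) (b I : set R) : tau_anns chRp b I ->
  tau chRp (ideal_mul (ideal_exp a (n + r - 1)) b)
    `<=` ideal_mul I (ideal_exp a n).
Proof.
move=> [M [z [fM cz ->]]] x xtau.
have [s [h ah]] := noetherian_gens R_noeth (ideal_exp_ideal a n).
rewrite ah; apply: ann_root_elt; apply: xtau; first exact: fin_gen_root_mod.
exact: tight_closure_root.
Qed.

End Skoda.

Theorem theorem2p1 (R : comNzRingType) (p : nat) (chRp : p \in [pchar R]%R)
    (R_noeth : noetherian R) (r : nat) (r_gt0 : (0 < r)%N) (g : 'I_r -> R)
    (a : set R) (a_gen : a = ideal_gen (range g)) :
  (forall n : nat,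
     (tau chRp (ideal_exp a (n + r - 1)) `<=` ideal_exp a n)%classic) /\
  (complete_local R ->
     forall (n : nat) (b : set R), ideal b ->
       (tau chRp (ideal_mul (ideal_exp a (n + r - 1)) b)
          `<=` ideal_mul (tau chRp b) (ideal_exp a n))%classic).
Proof.
subst a; split=> [n x|[m [m_max m_uniq m_compl]] n b _ x] xtau.
  rewrite -[ideal_exp _ n]ideal_mul1l; last exact: ideal_exp_ideal.
  (* The case z = 0, whose annihilator is the whole ring, with b = R. *)
  apply: (tau_sub_ann_mul R_noeth r_gt0 (tau_annsT chRp setT)).
  by rewrite ideal_mulC ideal_mul1l //; exact: ideal_exp_ideal.
apply: (krull_intersection R_noeth m_max m_uniq (ideal_mulP _ _)) => k.
have [|||I Ib Isub] := chevalley R_noeth m_max m_uniq m_compl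
  (F := tau_anns chRp b) k.
- by exists setT; exact: tau_annsT.
- exact: tau_anns_ideal.
- exact: tau_anns_filtered.
have := tau_sub_ann_mul R_noeth r_gt0 Ib xtau.
(* With Ann(z) inside tau(b) + m^k, the product with a^n splits into tau(b) a^n and a part inside
   m^k. *)
move/(ideal_mulS Isub (@subset_refl _ _)); rewrite -tauE.
move/(ideal_mulDl (tau_ideal _ _) (ideal_exp_ideal _ _)).
apply: ideal_add_min => [|y|y].
- by apply: ideal_addP; [exact: ideal_mulP|exact: ideal_exp_ideal].
- by apply: ideal_addl; exact: ideal_exp_ideal.
rewrite ideal_mulC => /(ideal_mul_subr (ideal_exp_ideal _ _)) my.
by apply: ideal_addr => //; exact: ideal_mulP.
Qed.
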